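(* Let $\mathcal{R}$ be a ring with unit $1\neq 0$ and with an involution $x\mapsto x^*$. Let $a,b,c\in\mathcal{R}$ be such that $a$ and $c$ are Moore-Penrose invertible, let $\widetilde{b}\in\mathcal{R}$, and put $p=a^\dagger abcc^\dagger$ and $q=cc^\dagger \widetilde{b} a^\dagger a$. Then the following conditions are equivalent: (i) $abc$ is Moore-Penrose invertible and $(abc)^{\dagger}=c^\dagger \widetilde{b} a^\dagger$; (iv) $q\in p\{1\}$, $a^*ap\mathcal{R}\supseteq q^*\mathcal{R}$ and $cc^*p^*\mathcal{R}\supseteq q\mathcal{R}$; (vi) $q\in p\{2\}$, $a^*ap\mathcal{R}\subseteq q^*\mathcal{R}$ and $cc^*p^*\mathcal{R}\subseteq q\mathcal{R}$.
   Context: $\mathcal{R}$ is a (not necessarily commutative) ring with unit $1\neq 0$ and an involution $x\mapsto x^*$, i.e. $(x^* )^*=x$, $(x+y)^*=x^*+y^*$, $(xy)^*=y^*x^*$ for all $x,y\in\mathcal{R}$. For $x\in\mathcal{R}$, the four Penrose equations for $y\in\mathcal{R}$ are: (1) $xyx=x$; (2) $yxy=y$; (3) $(xy)^*=xy$; (4) $(yx)^*=yx$. The element $x$ is Moore-Penrose invertible if some $y\in\mathcal{R}$ satisfies all four; such $y$ is then unique and denoted $x^\dagger$. For a set of indices, $x\{i,\ldots,j\}$ denotes the set of all $y\in\mathcal{R}$ satisfying equations $(i),\ldots,(j)$; thus $x\{1\}=\{y: xyx=x\}$ and $x\{2\}=\{y: yxy=y\}$. For $x\in\mathcal{R}$,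 $x\mathcal{R}=\{xr: r\in\mathcal{R}\}$. *)

(* Defs.v *)
From mathcomp Require Import all_boot all_algebra.
From mathcomp Require Import classical_sets.
Set Implicit Arguments.
Unset Strict Implicit.
Unset Printing Implicit Defensive.
Import GRing.Theory.
Local Open Scope ring_scope.
Local Open Scope classical_set_scope.

Definition ring_involution (R : nzRingType) (star : R -> R) : Prop :=
  [/\ forall x, star (star x) = x,
      forall x y, star (x + y) = star x + star y &
      forall x y, star (x * y) = star y * star x].

Definition inverses1 (R : nzRingType) (x : R) : set R :=
  [set y | x * y * x = x].
Definition inverses2 (R : nzRingType) (x : R) : set R :=
  [set y | y * x * y = y].

(* The four Penrose equations, as a boolean predicate so that [xchoose] below
   applies. *)
Definition penrose (R : nzRingType) (star : R -> R) (x y : R) : bool :=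
  [&& x * y * x == x, y * x * y == y,
      star (x * y) == x * y & star (y * x) == y * x].

Definition mp_invertible (R : nzRingType) (star : R -> R) (x : R) : Prop :=
  exists y, penrose star x y.

(* The Moore-Penrose inverse is defined only for Moore-Penrose invertible x;
   [mpinv] does not depend on the proof h, by [penrose_unique]. *)
Definition mpinv (R : nzRingType) (star : R -> R) (x : R)
  (h : mp_invertible star x) : R := xchoose h.

Lemma mpinvP (R : nzRingType) (star : R -> R) (x : R)
  (h : mp_invertible star x) : penrose star x (mpinv h).
Proof. exact: xchooseP. Qed.

Lemma penrose_unique (R : nzRingType) (star : R -> R) (x y z : R) :
  ring_involution star -> penrose star x y -> penrose star x z -> y = z.
Proof.
move=> [_ _ sM] /and4P[/eqP y1 /eqP y2 /eqP y3 /eqP y4].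
move=> /and4P[/eqP z1 /eqP z2 /eqP z3 /eqP z4].
have exy : x * y = x * z.
  have e : (x * z) * (x * y) = x * y by rewrite mulrA z1.
  by rewrite -y3 -e sM y3 z3 mulrA y1.
have eyx : y * x = z * x.
  have e : (y * x) * (z * x) = y * x by rewrite -mulrA (mulrA x) z1.
  by rewrite -y4 -e sM y4 z4 -mulrA (mulrA x) y1.
by rewrite -y2 eyx -mulrA exy mulrA z2.
Qed.

Definition rideal (R : nzRingType) (x : R) : set R := range (fun r => x * r).

(* Main.v *)
(* Write x' for the involution, e = ad a, f = c cd, A = a'a and C = cc', where
   ad and cd are the Moore-Penrose inverses.  Then p = ep = pf, q = qe = fq,
   abc = apc and cd bt ad = cd q ad, so (i) says that pqp = p, qpq = q and that
   a pq ad and cd qp c are hermitian.  Since A is invertible in eRe, with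
   inverse ad ad', the first hermitian condition reads A(pq) = (pq)'A.  Applying
   the same remark to c', p', q' instead of a, p, q turns the second one into
   C(p'q') = (p'q')'C.  An inclusion between ApR and q'R, together with one of
   pqp = p and qpq = q, amounts to A(pq) = (pq)'A together with both. *)
Require Import Defs.
From mathcomp Require Import all_boot all_algebra.
From mathcomp Require Import classical_sets.
Import GRing.Theory.
Local Open Scope ring_scope.
Local Open Scope classical_set_scope.

Lemma rideal_subP (R : nzRingType) (x y : R) :
  rideal x `<=` rideal y <-> exists r, x = y * r.
Proof.
split=> [sxy | [r ->] _ [s _ <-]]; last by exists (r * s); rewrite ?mulrA.
by have [|r _ yr] := sxy x; [exists 1; rewrite ?mulr1 | exists r].
Qed.

(** The star reverses products, so Penrose equations (3) and (4) trade places. This lets the lemmas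
    about [a] be applied to [star c]. *)
Lemma penrose_star {R : nzRingType} {star : R -> R} {x y : R} :
  ring_involution star -> penrose star x y -> penrose star (star x) (star y).
Proof.
move=> [sK _ sM] /and4P[/eqP e1 /eqP e2 /eqP e3 /eqP e4].
apply/and4P; split; apply/eqP; rewrite -!sM ?mulrA ?e1 ?e2 //.
- by rewrite e4.
- by rewrite e3.
Qed.

Lemma gram_inv {R : nzRingType} {star : R -> R} {a d : R} :
  ring_involution star -> penrose star a d ->
  star a * a * (d * star d) = d * a /\ d * star d * (star a * a) = d * a.
Proof.
move=> [sK _ sM] /and4P[/eqP e1 /eqP e2 /eqP e3 /eqP e4]; split.
- have e : star a * (a * d) = star a by rewrite -e3 -sM e1.
  by rewrite mulrA -(mulrA (star a)) e -sM e4.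
- have e : star d * star a * a = a by rewrite -sM e3 e1.
  by rewrite !mulrA -!(mulrA d) e.
Qed.

Lemma gram_star {R : nzRingType} {star : R -> R} (a : R) :
  ring_involution star -> star (star a * a) = star a * a.
Proof. by move=> [sK _ sM]; rewrite sM sK. Qed.

(** Multiplying by [star a] on the left and [a] on the right gives the weighted identity;
    multiplying that by [star d] and [d] goes back. *)
Lemma hermitian_conj {R : nzRingType} {star : R -> R} {a d x : R} :
  ring_involution star -> penrose star a d ->
  x * (d * a) = x ->
  star (a * x * d) = a * x * d <-> star a * a * x = star x * (star a * a).
Proof.
move=> hs pad xe; have [sK _ sM] := hs.
have /and4P[/eqP e1 /eqP e2 /eqP e3 /eqP e4] := pad.
have es : d * a * star x = star x by rewrite -e4 -sM xe.
have sad : star a * star d = d * a by rewrite -sM.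
split=> [h | h].
- transitivity (star a * (a * x * d) * a).
    by rewrite !mulrA -!(mulrA _ d) -(mulrA _ x) xe.
  by rewrite -h !sM !mulrA sad es.
- have ad : star d * star a * a = a by rewrite -sM e3 e1.
  have da : star a * (a * d) = star a by rewrite -e3 -sM e1.
  transitivity (star d * (star x * (star a * a)) * d).
    by rewrite !sM -!mulrA da.
  by rewrite -h !mulrA ad.
Qed.

Lemma weighted_sym_rideal_sub {R : nzRingType} {star : R -> R} {a d p q : R} :
  ring_involution star -> penrose star a d -> q * (d * a) = q ->
  q * p * q = q -> star a * a * (p * q) = star (p * q) * (star a * a) ->
  rideal (star q) `<=` rideal (star a * a * p).
Proof.
move=> hs pad qe qpq h; have [_ _ sM] := hs.
have /and4P[_ _ _ /eqP e4] := pad.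
have eq : d * a * star q = star q by rewrite -e4 -sM qe.
(* With B = dd', moving A across pq gives Ap(qBq') = (pq)'ABq' = (pq)'q' = (qpq)' = q'. *)
apply/rideal_subP; exists (q * (d * star d) * star q).
have [AB _] := gram_inv hs pad.
move: (star a * a) (d * star d) (d * a) => A B e in AB eq h *.
by rewrite !mulrA -(mulrA A) h -(mulrA _ A) AB -mulrA eq -sM mulrA qpq.
Qed.

Lemma rideal_sub_weighted_sym {R : nzRingType} {star : R -> R} {a d p q : R} :
  ring_involution star -> penrose star a d ->
  d * a * p = p -> q * (d * a) = q ->
  p * q * p = p -> rideal (star q) `<=` rideal (star a * a * p) ->
  star a * a * (p * q) = star (p * q) * (star a * a) /\ q * p * q = q.
Proof.
move=> hs pad ep qe pqp /rideal_subP[r qr]; have [sK _ sM] := hs.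
have [AB BA] := gram_inv hs pad.
have /and4P[_ _ _ /eqP e4] := pad.
have sB : star (d * star d) = d * star d by rewrite sM sK.
have eq : d * a * star q = star q by rewrite -e4 -sM qe.
move: (star a * a) (d * star d) (d * a) => A B e in AB BA sB ep qe eq qr e4 *.
(* From q' = Apr and BA = e comes Bq' = pr, which pq fixes because pqp = p. *)
have Bq : p * q * (B * star q) = B * star q.
  by rewrite qr !(mulrA B) BA ep mulrA pqp.
(* B(pq)' = (pq)B(pq)' is hermitian *)
have pqB : p * q * B * star (p * q) = B * star (p * q).
  by rewrite sM !mulrA -(mulrA _ B) Bq.
have sym : p * q * B = B * star (p * q).
  transitivity (star (B * star (p * q))); first by rewrite sM sK sB.
  by rewrite -pqB sM sK (sM (p * q)) sB mulrA.
have h : A * (p * q) = star (p * q) * A.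
  transitivity (A * (p * q * B) * A).
    by rewrite -!mulrA BA qe.
  rewrite sym !mulrA AB; congr (_ * _).
  by rewrite -[e]e4 -sM -mulrA qe.
(* Starred, the goal is (pq)'q' = q': insert AB before q', move A across by [h], then use that pq
   fixes Bq'. *)
split=> //; rewrite -[LHS]sK -[RHS]sK; congr star.
by rewrite -mulrA sM -{1}eq -AB -(mulrA A) mulrA -h -mulrA Bq mulrA AB eq.
Qed.

Lemma weighted_sym_rideal_sup {R : nzRingType} {star : R -> R} {a p q : R} :
  ring_involution star ->
  p * q * p = p -> star a * a * (p * q) = star (p * q) * (star a * a) ->
  rideal (star a * a * p) `<=` rideal (star q).
Proof.
(* Ap = A(pq)p = (pq)'Ap = q'(p'Ap). *)
move=> [_ _ sM] pqp h; apply/rideal_subP; exists (star p * (star a * a) * p).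
by rewrite -{1}pqp mulrA h sM !mulrA.
Qed.

Lemma rideal_sup_weighted_sym {R : nzRingType} {star : R -> R} {a d p q : R} :
  ring_involution star -> penrose star a d -> d * a * p = p ->
  q * p * q = q -> rideal (star a * a * p) `<=` rideal (star q) ->
  star a * a * (p * q) = star (p * q) * (star a * a) /\ p * q * p = p.
Proof.
move=> hs pad ep qpq /rideal_subP[r qr]; have [sK _ sM] := hs.
have [AB BA] := gram_inv hs pad; have sA := gram_star a hs.
move: (star a * a) (d * star d) (d * a) => A B e in AB BA sA ep qr *.
(* Ap lies in q'R, and (pq)'q' = (qpq)' = q'. *)
have Ap : star (p * q) * (A * p) = A * p.
  by rewrite qr mulrA -sM mulrA qpq.
(* A(pq) = (pq)'A(pq) is hermitian *)
have h : A * (p * q) = star (p * q) * A.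
  have pqApq : star (p * q) * A * (p * q) = A * (p * q).
    by rewrite !mulrA -(mulrA _ A) Ap.
  transitivity (star (A * (p * q))); last by rewrite sM sA.
  by rewrite -pqApq !(sM (_ * A)) (sM _ A) sA sK -[LHS]mulrA.
(* e(pqp) = BA(pq)p = B(pq)'Ap = BAp = p. *)
split=> //; transitivity (e * (p * q * p)); first by rewrite !mulrA ep.
by rewrite -BA -(mulrA B) (mulrA A) h -mulrA Ap mulrA BA ep.
Qed.

Lemma penrose_conj {R : nzRingType} {star : R -> R} {a d c g p q : R} :
  ring_involution star -> penrose star a d -> penrose star c g ->
  d * a * p = p -> p * (c * g) = p -> q * (d * a) = q -> c * g * q = q ->
  penrose star (a * p * c) (g * q * d) <->
  [/\ p * q * p = p, q * p * q = q,
      star a * a * (p * q) = star (p * q) * (star a * a) &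
      c * star c * (star p * star q) = star (star p * star q) * (c * star c)].
Proof.
move=> hs pad pcg ep pf qe fq; have [sK _ sM] := hs.
have apcg : a * p * c * g = a * p by rewrite -!mulrA pf.
have gqda : g * q * d * a = g * q by rewrite -!mulrA qe.
have xy : a * p * c * (g * q * d) = a * (p * q) * d.
  by rewrite !mulrA apcg.
have yx : g * q * d * (a * p * c) = g * (q * p) * c.
  by rewrite !mulrA gqda.
have /and4P[_ _ /eqP f3 _] := pcg.
have sf : star g * star c = c * g by rewrite -sM.
have qf : star q * (c * g) = star q by rewrite -f3 -sM fq.
have ha : star (a * (p * q) * d) = a * (p * q) * d <->
    star a * a * (p * q) = star (p * q) * (star a * a).
  by apply: (hermitian_conj hs pad); rewrite -mulrA qe.
have hc : g * (q * p) * c = star (g * (q * p) * c) <->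
    c * star c * (star p * star q) = star (star p * star q) * (c * star c).
  (* For [star c] and [star g] the conjugate c'(p'q')g' is the star of g(qp)c, whence the
     orientation of [hc]. *)
  have := hermitian_conj (x := star p * star q) hs (penrose_star hs pcg).
  have -> : star c * (star p * star q) * star g = star (g * (q * p) * c).
    by rewrite !sM !mulrA.
  by rewrite sf !sK; apply; rewrite -mulrA qf.
have e1 : a * p * c * (g * q * d) * (a * p * c) = a * (p * q * p) * c.
  by rewrite -mulrA yx !mulrA apcg.
have e2 : g * q * d * (a * p * c) * (g * q * d) = g * (q * p * q) * d.
  by rewrite -mulrA xy !mulrA gqda.
split=> [/and4P[/eqP] | [pqp qpq h3 h4]].
- rewrite e1 e2 xy yx => p1 /eqP p2 /eqP p3 /eqP p4; split.
  + by move/(congr1 (fun z => d * z * g)): p1; rewrite -!mulrA pf !mulrA ep.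
  + by move/(congr1 (fun z => c * z * a)): p2; rewrite -!mulrA qe !mulrA fq.
  + exact/ha.
  + by apply/hc; rewrite p4.
- apply/and4P; split; apply/eqP; rewrite ?e1 ?e2 ?pqp ?qpq ?xy ?yx //.
  + exact/ha.
  + exact/esym/hc.
Qed.

Theorem theorem2p6 (R : nzRingType) (star : R -> R)
    (hstar : ring_involution star) (a b c bt : R)
    (ha : mp_invertible star a) (hc : mp_invertible star c) :
  let ad := mpinv ha in
  let cd := mpinv hc in
  let p := ad * a * b * c * cd in
  let q := c * cd * bt * ad * a in
  [<-> (* (i) *)
       exists habc : mp_invertible star (a * b * c),
         mpinv habc = cd * bt * ad;
       (* (iv) *)
       [/\ inverses1 p q,
           rideal (star q) `<=` rideal (star a * a * p) &
           rideal q `<=` rideal (c * star c * star p)];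
       (* (vi) *)
       [/\ inverses2 p q,
           rideal (star a * a * p) `<=` rideal (star q) &
           rideal (c * star c * star p) `<=` rideal q]].
Proof.
move=> ad cd p q; have [sK _ sM] := hstar.
have pa : penrose star a ad := mpinvP ha.
have pc : penrose star c cd := mpinvP hc.
have /and4P[/eqP a1 /eqP a2 _ /eqP a4] := pa.
have /and4P[/eqP c1 /eqP c2 /eqP c3 _] := pc.
have ep : ad * a * p = p by rewrite /p !mulrA a2.
have pf : p * (c * cd) = p by rewrite /p -!mulrA (mulrA cd) c2.
have qe : q * (ad * a) = q by rewrite /q -!mulrA (mulrA a) a1.
have fq : c * cd * q = q by rewrite /q !mulrA c1.
have apc : a * p * c = a * b * c by rewrite /p !mulrA a1 -!mulrA (mulrA c) c1.
have cqa : cd * q * ad = cd * bt * ad.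
  by rewrite /q !mulrA c2 -!mulrA (mulrA ad) a2.
have pcs := penrose_star hstar pc.
have sf : star cd * star c = c * cd by rewrite -sM.
have fps : star cd * star c * star p = star p by rewrite sf -c3 -sM pf.
have qfs : star q * (star cd * star c) = star q by rewrite sf -c3 -sM fq.
have mpE := penrose_conj hstar pa pc ep pf qe fq; rewrite apc cqa in mpE.
have starxyx x y : x * y * x = x -> star x * star y * star x = star x.
  by move=> e; rewrite -!sM mulrA e.
have unstarxyx x y : star x * star y * star x = star x -> x * y * x = x.
  by move=> /starxyx; rewrite !sK.
tfae.
- move=> [habc hE]; have := mpinvP habc; rewrite hE.
  move=> /mpE[pqp qpq h3 h4]; split=> //.
  + exact: weighted_sym_rideal_sub hstar pa qe qpq h3.
  (* The inclusion for [c] is the one for [a] read with [star c], [star cd], [star p], [star q] in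
     place of [a], [ad], [p], [q]. *)
  + have := weighted_sym_rideal_sub hstar pcs qfs (starxyx _ _ qpq).
    by rewrite !sK; apply.
- move=> [pqp inA inC].
  have [h3 qpq] := rideal_sub_weighted_sym hstar pa ep qe pqp inA.
  have := rideal_sub_weighted_sym hstar pcs fps qfs (starxyx _ _ pqp).
  rewrite !sK => /(_ inC)[h4 _]; split=> //.
  + exact: weighted_sym_rideal_sup hstar pqp h3.
  + have := weighted_sym_rideal_sup (a := star c) hstar (starxyx _ _ pqp).
    by rewrite !sK; apply.
- move=> [qpq inA inC].
  have [h3 pqp] := rideal_sup_weighted_sym hstar pa ep qpq inA.
  have := rideal_sup_weighted_sym hstar pcs fps (starxyx _ _ qpq).
  rewrite !sK => /(_ inC)[h4 _].
  have pabc : penrose star (a * b * c) (cd * bt * ad) by exact/mpE.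
  have habc : mp_invertible star (a * b * c) by exists (cd * bt * ad).
  by exists habc; apply: penrose_unique hstar (mpinvP habc) pabc.
Qed.
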